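(* Let $V$ be a finite-dimensional real inner product space, let $A\colon V\to V$ be symmetric positive semidefinite with $A\ne0$, let $f\in\mathcal R(A)$, and let $B\colon V\to V$ be a linear operator. If the symmetrized operator $\bar B=B+B^t-B^tAB$ is SPD, then the iterative method $u^{m+1}=u^m+B(f-Au^m)$, $m\ge0$, for solving $Au=f$ converges, and $$|I-BA|_A^2=1-\left(\sup_{v\in\mathcal R(A),\ |v|_A=1}\ \inf_{\phi\in\mathcal N(A)}(\bar B^{-1}(v+\phi),v+\phi)\right)^{-1}.$$
   Context: $T^t$ is the adjoint, $\mathcal N(T)$ the null space, $\mathcal R(T)$ the range of a linear operator $T$. A symmetric operator $T$ is SPD if $(Tv,v)>0$ for all $v\ne0$, and symmetric positive semidefinite (semi-SPD) if $(Tv,v)\ge 0$ for all $v$. For semi-SPD $T$, $|v|_T=(Tv,v)^{1/2}$, and for a linear operator $S$, $|S|_T=\sup_{|v|_T=1}|Sv|_T$. Convergence of an iterative method $\{u^m\}$ for the semi-SPD system $Au=f$ means: $Qu^m\to Qu$ for every initial guess $u^0\in V$, where $Q$ is the orthogonal projection of $V$ onto $\mathcal R(A)$ and $u$ is any solution of $Au=f$ ($Qu$ does not depend on the choice of $u$). *)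

(* Defs.v *)
From HB Require Import structures.
From mathcomp Require Import all_boot all_order all_algebra.
From mathcomp Require Import all_classical all_reals all_analysis.
Set Implicit Arguments.
Unset Strict Implicit.
Unset Printing Implicit Defensive.
Import Order.TTheory GRing.Theory Num.Theory.
Import numFieldNormedType.Exports.
Local Open Scope classical_set_scope.
Local Open Scope ring_scope.

(* MathComp: a finite-dimensional real inner product space is a [vectType] over
   a [realType] together with a form [dot : {dot V for idfun}] (bilinear,
   symmetric and positive definite); linear operators on [V] are the elements
   of ['End(V)]. *)

Definition symmetric_op (R : realType) (V : vectType R)
    (dot : {dot V for idfun}) (T : 'End(V)) : Prop :=
  forall u v, dot (T u) v = dot u (T v).

Definition semi_spd (R : realType) (V : vectType R)
    (dot : {dot V for idfun}) (T : 'End(V)) : Prop :=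
  symmetric_op dot T /\ (forall v, 0 <= dot (T v) v).

Definition spd (R : realType) (V : vectType R)
    (dot : {dot V for idfun}) (T : 'End(V)) : Prop :=
  symmetric_op dot T /\ (forall v, v != 0 -> 0 < dot (T v) v).

(* The default value 0 of [xget] is never reached, see [adjointP] below. *)
Definition adjoint (R : realType) (V : vectType R)
    (dot : {dot V for idfun}) (T : 'End(V)) : 'End(V) :=
  xget 0 [set S : 'End(V) | forall u v, dot (T u) v = dot u (S v)].

Definition ortho_proj (R : realType) (V : vectType R)
    (dot : {dot V for idfun}) (U : {vspace V}) : 'End(V) :=
  daddv_pi U (orthov dot U).

Definition seminorm (R : realType) (V : vectType R)
    (dot : {dot V for idfun}) (T : 'End(V)) (v : V) : R :=
  Num.sqrt (dot (T v) v).

(* Extended-real valued: the supremum is infinite when [S] does not map the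
   null space of [T] into itself. *)
Definition op_seminorm (R : realType) (V : vectType R)
    (dot : {dot V for idfun}) (T S : 'End(V)) : \bar R :=
  ereal_sup [set (seminorm dot T (S v))%:E | v in
               [set v : V | seminorm dot T v = 1]].

Definition ip_cvg (R : realType) (V : vectType R)
    (dot : {dot V for idfun}) (x : nat -> V) (l : V) : Prop :=
  (Num.sqrt (dot (x m - l) (x m - l)) @[m --> \oo] --> (0 : R)).

Definition iteration (R : realType) (V : vectType R)
    (A B : 'End(V)) (f u0 : V) (m : nat) : V :=
  iter m (fun u => u + B (f - A u)) u0.

(* [x u0] is the sequence of iterates with initial guess [u0]. *)
Definition method_converges (R : realType) (V : vectType R)
    (dot : {dot V for idfun}) (A : 'End(V)) (f : V) (x : V -> nat -> V)
    : Prop :=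
  let Q := ortho_proj dot (limg A) in
  forall u0 u : V, A u = f -> ip_cvg dot (fun m => Q (x u0 m)) (Q u).

Definition symmetrized (R : realType) (V : vectType R)
    (dot : {dot V for idfun}) (A B : 'End(V)) : 'End(V) :=
  let Bt := adjoint dot B in B + Bt - (Bt \o (A \o B))%VF.

Lemma dot_eq0 (R : realType) (V : vectType R) (dot : {dot V for idfun})
  (v : V) : dot v v = 0 -> v = 0.
Proof.
move=> vv; apply/eqP; apply: contraT => /(neq0_dnorm_gt0 (s := dot)).
by rewrite vv ltxx.
Qed.

Lemma adjoint_exists (R : realType) (V : vectType R)
  (dot : {dot V for idfun}) (T : 'End(V)) :
  exists S : 'End(V), forall u v, dot (T u) v = dot u (S v).
Proof.
pose b := vbasis {:V}.
have bP (w : V) : w = \sum_i coord b i w *: b`_i.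
  by apply: coord_vbasis; exact: memvf.
pose g (v : V) := \row_(i < \dim {:V}) dot b`_i v.
have g_lin : linear g.
  by move=> a u v; apply/rowP => i; rewrite !mxE linearPr.
pose gL := GRing.isLinear.Build _ _ _ _ g g_lin.
pose gl : {linear V -> 'rV[R]_(\dim {:V})} := HB.pack g gL.
pose G := linfun gl.
have gE v w : g v = g w -> forall u, dot u v = dot u w.
  move=> /rowP gvw u; rewrite (bP u) !linear_sumlz; apply: eq_bigr => i _.
  by rewrite !linearZl_LR; congr (_ * _); have := gvw i; rewrite !mxE.
have kG : lker G == 0%VS.
  apply/lker0P => v w; rewrite !lfunE /= => /gE vw.
  apply/eqP; rewrite -subr_eq0; apply/eqP/(@dot_eq0 _ _ dot).
  by rewrite linearBr; apply/eqP; rewrite subr_eq0; apply/eqP/vw.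
have imG : limg G = fullv.
  apply/eqP; rewrite eqEdim subvf /= limg_dim_eq ?(eqP kG) ?capv0 //.
  by rewrite [leqLHS]dimvf /dim /= mul1n.
pose h (v : V) := \row_(i < \dim {:V}) dot (T b`_i) v.
have h_lin : linear h.
  by move=> a u v; apply/rowP => i; rewrite !mxE linearPr.
pose hL := GRing.isLinear.Build _ _ _ _ h h_lin.
pose hl : {linear V -> 'rV[R]_(\dim {:V})} := HB.pack h hL.
exists (G^-1 \o linfun hl)%VF => u v.
have GS : g ((G^-1 \o linfun hl)%VF v) = h v.
  have := @limg_lfunVK _ _ _ G (h v).
  by rewrite imG memvf lfunE /= => /(_ isT) <-; rewrite lfunE /= [linfun hl v]lfunE.
rewrite (bP u) linear_sum !linear_sumlz; apply: eq_bigr => i _.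
rewrite linearZ !linearZl_LR; congr (_ * _).
by move/rowP: GS => /(_ i); rewrite !mxE.
Qed.

Lemma adjointP (R : realType) (V : vectType R)
  (dot : {dot V for idfun}) (T : 'End(V)) (u v : V) :
  dot (T u) v = dot u (adjoint dot T v).
Proof.
rewrite /adjoint; case: xgetP => [S _ |no]; first exact.
by have [S /no] := adjoint_exists dot T.
Qed.

Lemma ortho_projP (R : realType) (V : vectType R)
  (dot : {dot V for idfun}) (U : {vspace V}) (v : V) :
  ortho_proj dot U v \in U /\
  (forall w, w \in U -> dot (v - ortho_proj dot U v) w = 0).
Proof.
set P := projv U; set Pt := adjoint dot P.
have kPt : lker Pt = orthov dot U.
  apply/vspaceP => w; rewrite memv_ker; apply/eqP/mem_orthovP.
    move=> Ptw u uU; rewrite hermC expr0 mul1r /=.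
    by rewrite -(projv_id uU) adjointP Ptw linear0r.
  move=> wU; apply: (@dot_eq0 _ _ dot).
  by rewrite -adjointP hermC expr0 mul1r /= wU // memv_proj.
have cap0 : (U :&: orthov dot U = 0)%VS.
  apply/eqP; rewrite -subv0; apply/subvP => w /memv_capP [wU /mem_orthovP wo].
  by rewrite memv0; apply/eqP/(@dot_eq0 _ _ dot)/wo.
have capP : (limg Pt :&: lker P = 0)%VS.
  apply/eqP; rewrite -subv0; apply/subvP => w.
  move=> /memv_capP [/memv_imgP [u _ ->]]; rewrite memv_ker => /eqP PPt0.
  by rewrite memv0; apply/eqP/(@dot_eq0 _ _ dot); rewrite -adjointP PPt0 linear0l.
have dP : (\dim (lker P) + \dim U)%N = \dim {:V}.
  have := limg_ker_dim P fullv; rewrite capfv.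
  suff -> : limg P = U by [].
  by apply/vspaceP => w; apply/idP/idP => [/memv_imgP [u _ ->]|wU];
     [exact: memv_proj | rewrite -(projv_id wU) memv_img ?memvf].
have dPt := limg_ker_dim Pt fullv; rewrite capfv kPt in dPt.
have dle : (\dim (limg Pt) + \dim (lker P) <= \dim {:V})%N.
  by rewrite -dimv_disjoint_sum // dimvS ?subvf.
have full : (U + orthov dot U = fullv)%VS.
  apply/eqP; rewrite eqEdim subvf dimv_disjoint_sum //=.
  rewrite -[leqLHS]dPt addnC leq_add2r.
  by rewrite -(leq_add2r (\dim (lker P))) (addnC (\dim U)) dP.
rewrite /ortho_proj; split; first exact: memv_pi.
move=> w wU; have := daddv_pi_add cap0 (w := v).
rewrite full memvf => /(_ isT) {1}<-; rewrite addrC addKr.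
by move: w wU; apply/mem_orthovP; exact: memv_pi.
Qed.

(* Hence [(T^-1)%VF], in general only a one-sided inverse on the image of [T],
   is the genuine inverse of an SPD operator [T]. *)
Lemma spd_lker0 (R : realType) (V : vectType R) (dot : {dot V for idfun})
  (T : 'End(V)) : spd dot T -> lker T == 0%VS.
Proof.
move=> [_ Tpos]; rewrite -subv0; apply/subvP => w.
rewrite memv_ker memv0 => /eqP Tw0; apply: contraT => /Tpos.
by rewrite Tw0 linear0l ltxx.
Qed.

(* Main.v *)
(** Write [Bbar] for the symmetrized operator, [E = I - B A] and
    [q z = (Bbar A z, A z)]. Expanding squares gives [|E z|_A^2 = |z|_A^2 - q z],
    so [|E|_A^2 = 1 - inf q] over [|z|_A = 1]. In finite dimension [q] dominates
    a positive multiple of [|z|_A^2], hence [|E|_A < 1] and the error decays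
    geometrically.

    It remains to see that the supremum [K] in the statement equals [1 / inf q].
    Let [|z|_A = 1] and [A w = A z]. By Cauchy-Schwarz for [Bbar],
    [1 = (w, A z)^2 <= (Bbar^-1 w, w) q z], so [K >= 1 / q z]. Conversely,
    given [v] with [|v|_A = 1], solve [A Bbar A z = A v] and put [w = Bbar A z],
    which lies in [v + N(A)]; then [(Bbar^-1 w, w) = q z = (v, z)_A <= |z|_A],
    and [inf q |z|_A^2 <= q z] yields [(Bbar^-1 w, w) <= 1 / inf q]. *)

Require Import Defs.
From mathcomp Require Import all_boot all_order all_algebra.
From mathcomp Require Import all_classical all_reals all_analysis.
From HB Require Import structures.
From mathcomp Require Import ring lra.
Import Order.TTheory GRing.Theory Num.Theory.
Import numFieldNormedType.Exports.
Local Open Scope classical_set_scope.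
Local Open Scope ring_scope.

Section InnerProduct.
Context {R : realType} {V : vectType R} {dot : {dot V for idfun}}.
Implicit Types (u v w : V) (T : 'End(V)).

(** * Rules for the inner product and for semi-SPD forms *)

Lemma dotC u v : dot u v = dot v u.
Proof. by rewrite hermC expr0 mul1r. Qed.

Lemma dotDl u v w : dot (u + v) w = dot u w + dot v w.
Proof. exact: linearDl. Qed.

Lemma dotDr u v w : dot w (u + v) = dot w u + dot w v.
Proof. exact: linearDr. Qed.

Lemma dotBl u v w : dot (u - v) w = dot u w - dot v w.
Proof. exact: linearBl. Qed.

Lemma dotBr u v w : dot w (u - v) = dot w u - dot w v.
Proof. exact: linearBr. Qed.

Lemma dotZl a u v : dot (a *: u) v = a * dot u v.
Proof. exact: linearZl_LR. Qed.

Lemma dotZr a u v : dot u (a *: v) = a * dot u v.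
Proof. exact: linearZr_LR. Qed.

Lemma dot_ge0 v : 0 <= dot v v.
Proof.
by have [->|/(neq0_dnorm_gt0 (s := dot))/ltW//] := eqVneq v 0; rewrite linear0l.
Qed.

Lemma semi_spd_id : semi_spd dot \1%VF.
Proof. by split=> [u v|v]; rewrite !id_lfunE // dot_ge0. Qed.

Lemma spd_semi {T} : spd dot T -> semi_spd dot T.
Proof.
move=> [Ts Tp]; split=> // v.
by have [->|/Tp/ltW//] := eqVneq v 0; rewrite linear0r.
Qed.

(** Nonnegativity of the form is tested at one well-chosen combination of [u] and [v]; since [T] may
    be singular, the case [dot (T v) v = 0] is treated apart. *)
Lemma semi_spd_CauchySchwarz {T} u v : semi_spd dot T ->
  dot (T u) v ^+ 2 <= dot (T u) u * dot (T v) v.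
Proof.
move=> [Ts Tp].
have E a b : dot (T (a *: u + b *: v)) (a *: u + b *: v) =
  a ^+ 2 * dot (T u) u + a * b * dot (T u) v *+ 2 + b ^+ 2 * dot (T v) v.
  rewrite (_ : T _ = a *: T u + b *: T v); last by rewrite linearD !linearZ.
  rewrite dotDl !dotDr !dotZl !dotZr (Ts v u) (dotC v (T u)).
  by ring.
set a := dot (T u) u in E *; set b := dot (T u) v in E *.
set c := dot (T v) v in E *.
have c0 : 0 <= c by exact: Tp.
have [c0'|cn0] := eqVneq c 0.
  have [->|bn0] := eqVneq b 0; first by rewrite c0' mulr0 expr0n.
  (* For [c = 0] the form at [u + t v] equals [a + 2 t b], affine in [t]; this [t] makes it [-1],
     which is impossible. *)
  have := Tp (1 *: u + (- (a + 1) / (2 * b)) *: v); rewrite E c0'.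
  have -> : 1 ^+ 2 * a + 1 * (- (a + 1) / (2 * b)) * b *+ 2 +
    (- (a + 1) / (2 * b)) ^+ 2 * 0 = -1 by field.
  by lra.
have cp : 0 < c by rewrite lt_def cn0.
have := Tp (c *: u + (- b) *: v); rewrite E.
have -> : c ^+ 2 * a + c * - b * b *+ 2 + (- b) ^+ 2 * c = c * (a * c - b ^+ 2).
  by ring.
by rewrite pmulr_rge0 // subr_ge0.
Qed.

Lemma semi_spd_ker {T v} : semi_spd dot T -> dot (T v) v = 0 -> T v = 0.
Proof.
move=> Tsp Tv0; have := semi_spd_CauchySchwarz v (T v) Tsp.
rewrite Tv0 mul0r => le; apply: (@dot_eq0 _ _ dot); apply/eqP.
by rewrite -sqrf_eq0 eq_le le sqr_ge0.
Qed.

Lemma semi_spd_normalize {T v} : semi_spd dot T -> T v != 0 ->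
  exists2 t, t != 0 & dot (T (t *: v)) (t *: v) = 1.
Proof.
move=> Tsp Tv0; have T0 : 0 < dot (T v) v.
  rewrite lt_def Tsp.2 andbT; apply: contra_neq Tv0; exact: semi_spd_ker.
exists (Num.sqrt (dot (T v) v))^-1; first by rewrite invr_eq0 sqrtr_eq0 -ltNge.
rewrite (_ : T _ = (Num.sqrt (dot (T v) v))^-1 *: T v); last by rewrite linearZ.
rewrite dotZl dotZr mulrA -expr2 exprVn sqr_sqrtr ?mulVf ?gt_eqF //; exact: ltW.
Qed.

(** * Quadratic bounds for operators and projections *)

Lemma dot_CauchySchwarz u v : dot u v ^+ 2 <= dot u u * dot v v.
Proof. by have := semi_spd_CauchySchwarz u v semi_spd_id; rewrite !id_lfunE. Qed.

(* Apply the adjoint of the rank-one operator [v |-> coord i v *: e_i] to [e_i]. *)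
Lemma coord_riesz i : exists r, forall v, coord (vbasis {:V}) i v = dot v r.
Proof.
set e := (vbasis {:V})`_i.
have e0 : dot e e != 0.
  apply/eqP => /(@dot_eq0 _ _ dot) e0.
  have := free_not0 (basis_free (vbasisP {:V})) (v := e).
  by rewrite e0 eqxx => /implyP; rewrite implybF -e0 mem_nth // size_tuple.
pose g v := coord (vbasis {:V}) i v *: e.
have g_lin : linear g by move=> a u v; rewrite /g linearP scalerDl scalerA.
pose gl : {linear V -> V} :=
  HB.pack g (GRing.isLinear.Build _ _ _ _ g g_lin).
exists ((dot e e)^-1 *: adjoint dot (linfun gl) e) => v.
by rewrite dotZr -adjointP lfunE /= /g dotZl; field.
Qed.

(** Expanding the first [v] in a basis leaves products [x y] of two functionals of [v];
    [2 x y <= x^2 + y^2] and Cauchy-Schwarz bound each. Applied to [T^-1] below, this replaces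
    compactness or spectral arguments. *)
Lemma lfun_form_bounded T :
  exists2 C, 0 < C & forall v, dot (T v) v <= C * dot v v.
Proof.
pose b := vbasis {:V}.
have [r rP] := choice coord_riesz.
exists (1 + \sum_i (dot (r i) (r i) + dot (T b`_i) (T b`_i))).
  by rewrite ltr_wpDr // sumr_ge0 // => i _; rewrite addr_ge0 ?dot_ge0.
move=> v; have v0 := dot_ge0 v.
rewrite {1}(coord_vbasis (memvf v)) linear_sum linear_sumlz mulrDl mul1r.
rewrite ler_wpDl // mulr_suml ler_sum // => i _.
rewrite [X in dot X _ <= _]linearZ dotZl rP.
have := dot_CauchySchwarz v (r i); have := dot_CauchySchwarz (T b`_i) v.
have := sqr_ge0 (dot v (r i) - dot (T b`_i) v).
have := dot_ge0 (r i); have := dot_ge0 (T b`_i).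
set x := dot v (r i); set y := dot (T b`_i) v => *.
by nra.
Qed.

Lemma spd_invK {T} v : spd dot T -> T (T^-1%VF v) = v.
Proof. by move=> /spd_lker0 /lker0_lfunVK. Qed.

(* With [y = T^-1 x], [|x|^4 = (T x, y)^2 <= (T x, x) (x, T^-1 x)]. *)
Lemma spd_coercive {T} : spd dot T ->
  exists2 C, 0 < C & forall v, dot v v <= C * dot (T v) v.
Proof.
move=> Tspd; have [C C0 CP] := lfun_form_bounded T^-1%VF.
exists C => // v; have [->|v0] := eqVneq v 0.
  by rewrite !linear0l linear0r mulr0.
have vv : 0 < dot v v by rewrite (neq0_dnorm_gt0 (s := dot)).
have := semi_spd_CauchySchwarz (T^-1%VF v) v (spd_semi Tspd).
rewrite spd_invK // => cs; have := CP v.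
rewrite (dotC (T^-1%VF v) v) => le.
have Tv : 0 < dot (T v) v by apply: Tspd.2.
rewrite -(ler_pM2l vv) mulrCA -expr2 (le_trans cs) //.
by rewrite mulrA ler_wpM2r // ltW.
Qed.

(** Although [T^-1] inverts [T] only on its range, [T (T^-1 (T v)) = T v], so
    [(T v, v) = (T^-1 (T v), T v)]. *)
Lemma semi_spd_range_coercive {T} : semi_spd dot T ->
  exists2 C, 0 < C & forall v, dot (T v) v <= C * dot (T v) (T v).
Proof.
move=> [Ts _]; have [C C0 CP] := lfun_form_bounded T^-1%VF.
exists C => // v; rewrite (le_trans _ (CP (T v))) //.
by rewrite -Ts limg_lfunVK // memv_img ?memvf.
Qed.

Lemma ortho_proj_range {T} v : symmetric_op dot T ->
  T (ortho_proj dot (limg T) v) = T v.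
Proof.
move=> Ts.
have [_ /(_ (T _) (memv_img _ (memvf _))) o] := ortho_projP dot (limg T) v.
apply/esym/eqP; rewrite -subr_eq0 -linearB; apply/eqP/(@dot_eq0 _ _ dot).
by rewrite Ts o.
Qed.

(** Turns energy decay into convergence of the projected iterates. For the projection [w] of [v],
    [|w|^4 = (T (T^-1 w), v)^2 <= (T^-1 w, w) (T v, v)], and the first factor is at most
    [C |w|^2]. *)
Lemma ortho_proj_bounded {T} : semi_spd dot T ->
  exists2 C, 0 < C & forall v,
    dot (ortho_proj dot (limg T) v) (ortho_proj dot (limg T) v)
      <= C * dot (T v) v.
Proof.
move=> Tsp; have [C C0 CP] := lfun_form_bounded T^-1%VF.
exists C => // v; have [wT _] := ortho_projP dot (limg T) v.
set w := ortho_proj dot (limg T) v in wT *.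
have [->|w0] := eqVneq w 0; first by rewrite linear0l mulr_ge0 ?Tsp.2 // ltW.
have ww : 0 < dot w w by rewrite (neq0_dnorm_gt0 (s := dot)).
have := semi_spd_CauchySchwarz (T^-1%VF w) v Tsp.
rewrite limg_lfunVK // (dotC w (T^-1%VF w)).
have -> : dot w v = dot w w.
  have E x : dot w x = dot (T^-1%VF w) (T x) by rewrite -Tsp.1 limg_lfunVK.
  by rewrite !E -(ortho_proj_range v Tsp.1).
move=> cs; rewrite -(ler_pM2l ww) mulrCA -expr2 (le_trans cs) //.
by rewrite mulrA ler_wpM2r ?CP // Tsp.2.
Qed.

Lemma seminorm_eq1 {T} v : semi_spd dot T ->
  (seminorm dot T v = 1) <-> (dot (T v) v = 1).
Proof.
move=> [_ Tp]; rewrite /seminorm; split=> [|->]; last exact: sqrtr1.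
by move=> s1; rewrite -[LHS](sqr_sqrtr (Tp v)) s1 expr1n.
Qed.

(** * Energy of the error and convergence of the method *)

Section Symmetrized.
Context {A B : 'End(V)} (Asp : semi_spd dot A)
  (Bspd : spd dot (symmetrized dot A B)).
Local Notation Bbar := (symmetrized dot A B).

Lemma error_energy v : let e := v - B (A v) in
  dot (A e) e = dot (A v) v - dot (Bbar (A v)) (A v).
Proof.
move=> e; rewrite /e /symmetrized; set w := A v.
have -> : A (v - B w) = w - A (B w) by rewrite linearB.
rewrite !lfunE /= !lfunE /= !lfunE /= comp_lfunE !(dotBl, dotBr, dotDl) /=.
rewrite (dotC (adjoint _ _ _) w) -!adjointP (Asp.1 (B w) v) -/w.
rewrite (dotC (adjoint _ _ _) w) -adjointP (dotC w (B w)) (dotC (A _) (B w)).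
by ring.
Qed.

Lemma symmetrized_energy_ge0 v : 0 <= dot (Bbar (A v)) (A v).
Proof. exact: (spd_semi Bspd).2. Qed.

Lemma symmetrized_energy_coercive :
  exists2 C, 0 < C & forall v, dot (A v) v <= C * dot (Bbar (A v)) (A v).
Proof.
have [C C0 CP] := semi_spd_range_coercive Asp.
have [D D0 DP] := spd_coercive Bspd.
exists (C * D); first exact: mulr_gt0.
move=> v; rewrite (le_trans (CP v)) // -mulrA ler_wpM2l ?DP //; exact: ltW.
Qed.

(** Definiteness of [Bbar] gives [A Bbar A] the kernel of [A]; its range lies in that of [A], and
    rank-nullity makes the ranges equal. *)
Lemma symmetrized_solve v : exists z, A (Bbar (A z)) = A v.
Proof.
pose M := (A \o (Bbar \o A))%VF.
have kM : lker M = lker A.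
  apply/vspaceP => z; rewrite !memv_ker !comp_lfunE.
  apply/eqP/eqP => [Mz|->]; last by rewrite !linear0.
  apply/eqP; apply: contraT => /Bspd.2.
  by rewrite -Asp.1 Mz linear0l ltxx.
have sM : (limg M <= limg A)%VS.
  by apply/subvP => _ /memv_imgP [z _ ->]; rewrite comp_lfunE memv_img ?memvf.
have MA : limg M = limg A.
  apply/eqP; rewrite eqEdim sM /= -(leq_add2l (\dim (lker A))).
  have := limg_ker_dim M fullv; have := limg_ker_dim A fullv.
  by rewrite !capfv kM => -> ->.
have : A v \in limg M by rewrite MA memv_img ?memvf.
by case/memv_imgP => z _ ->; exists z; rewrite !comp_lfunE.
Qed.

Lemma iteration_converges f : method_converges dot A f (iteration A B f).
Proof.
move=> /= u0 u Auf.
have [C C0 CP] := symmetrized_energy_coercive.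
have [D D0 DP] := ortho_proj_bounded Asp.
(* Taking [1 + C] instead of [C] ensures [0 <= rho], which the induction in [decay] needs. *)
pose rho := 1 - (1 + C)^-1; pose e m := iteration A B f u0 m - u.
have C1 : 0 < 1 + C by rewrite addr_gt0.
have rho0 : 0 <= rho by rewrite subr_ge0 invf_le1 // lerDl ltW.
have rho1 : `|rho| < 1 by rewrite ger0_norm // ltrBlDr ltrDl invr_gt0.
have eS m : e m.+1 = e m - B (A (e m)).
  rewrite /e /=; set x := iteration A B f u0 m.
  have -> : f - A x = - A (x - u) by rewrite -Auf linearB opprB.
  by rewrite linearN addrAC.
have step v : dot (A (v - B (A v))) (v - B (A v)) <= rho * dot (A v) v.
  rewrite error_energy /rho mulrBl mul1r lerB // ler_pdivrMl // mulrDl mul1r.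
  by rewrite (le_trans (CP v)) // lerDr symmetrized_energy_ge0.
have decay m : dot (A (e m)) (e m) <= rho ^+ m * dot (A (e 0)) (e 0).
  elim: m => [|m IH]; first by rewrite mul1r.
  by rewrite eS (le_trans (step _)) // exprS -mulrA ler_wpM2l.
pose a := D * dot (A (e 0)) (e 0).
rewrite /ip_cvg; apply: (@squeeze_cvgr _ _ _ _ (fun=> 0)
  (fun m => Num.sqrt (geometric a rho m))).
- near=> m; rewrite sqrtr_ge0 /= -linearB -/(e m) ler_wsqrtr //.
  rewrite (le_trans (DP (e m))) // /a -mulrA ler_wpM2l //; first exact: ltW.
  by rewrite mulrC.
- exact: cvg_cst.
- rewrite -[X in _ --> X](sqrtr0 R).
  apply: (@continuous_cvg _ R R _ _ (geometric a rho) Num.sqrt).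
    exact: sqrt_continuous.
  exact: cvg_geometric.
Unshelve. all: by end_near.
Qed.

(** * The supremum formula for the contraction factor *)

Lemma inf_energy_le (lambda : R) v : 0 < lambda ->
  (forall z, lambda * dot (A z) z <= dot (Bbar (A z)) (A z)) ->
  dot (A v) v = 1 ->
  exists2 phi, phi \in lker A &
    dot (Bbar^-1%VF (v + phi)) (v + phi) <= lambda^-1.
Proof.
move=> l0 lP Av1; have [z zP] := symmetrized_solve v.
set w := Bbar (A z) in zP.
exists (w - v); first by rewrite memv_ker linearB /= zP subrr.
rewrite addrC subrK (_ : Bbar^-1%VF w = A z); last first.
  exact: lker0_lfunK (spd_lker0 Bspd) _.
(* With [c = (A z, w)], this gives [c^2 <= (A z, z)], while [lP] gives [lambda (A z, z) <= c]; hence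
   [lambda c^2 <= c], and one divides by [c] unless it vanishes. *)
have := semi_spd_CauchySchwarz v z Asp; rewrite Av1 mul1r -zP Asp.1 dotC.
set c := dot (A z) w => cs.
have := lP z; rewrite -/w (dotC w) -/c => le.
have c0 : 0 <= c by rewrite /c dotC symmetrized_energy_ge0.
have [->|cn0] := eqVneq c 0; first by rewrite invr_ge0 ltW.
have cp : 0 < c by rewrite lt_def cn0.
rewrite -[leRHS]mul1r ler_pdivlMr // mulrC -(ler_pM2r cp) mul1r -mulrA -expr2.
by rewrite (le_trans _ le) // ler_pM2l.
Qed.

Lemma inf_energy_ge z w : dot (A z) z = 1 -> A w = A z ->
  (dot (Bbar (A z)) (A z))^-1 <= dot (Bbar^-1%VF w) w.
Proof.
move=> Az1 Aw.
have q0 : 0 < dot (Bbar (A z)) (A z).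
  apply: Bspd.2; apply: contra_eq_neq Az1 => ->.
  by rewrite linear0l eq_sym oner_eq0.
have := semi_spd_CauchySchwarz (Bbar^-1%VF w) (A z) (spd_semi Bspd).
rewrite spd_invK // -Asp.1 Aw Az1 expr1n (dotC w).
by rewrite -[_^-1]mul1r ler_pdivrMr.
Qed.

Lemma seminorm_contraction_identity : A != 0 ->
  ((op_seminorm dot A (\1%VF - (B \o A)%VF)%R) ^+ 2 =
   1 - (ereal_sup
          [set ereal_inf
             [set (dot (Bbar^-1%VF (v + phi)%R) (v + phi)%R)%:E
               | phi in [set phi : V | phi \in lker A]]
            | v in [set v : V | v \in limg A /\ seminorm dot A v = 1%R]])^-1)%E.
Proof.
move=> An0; set K := ereal_sup _.
pose q z := dot (Bbar (A z)) (A z).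
have K_ge z : dot (A z) z = 1 -> ((q z)^-1%:E <= K)%E.
  (* The supremum sees only the range of [A]; projecting [z] there changes neither [A z] nor the
     energy. *)
  move=> Az1; pose v := ortho_proj dot (limg A) z.
  have vA := (ortho_projP dot (limg A) z).1; rewrite -/v in vA.
  have Av : A v = A z by rewrite ortho_proj_range; last exact: Asp.1.
  have Av1 : dot (A v) v = 1 by rewrite Av Asp.1 Av -Asp.1.
  apply: le_trans (ereal_sup_ubound _); last first.
    by exists v => //; split=> //; apply/seminorm_eq1.
  apply: le_ereal_inf_tmp => _ [phi phiA <-].
  rewrite lee_fin inf_energy_ge // linearD /= Av.
  by move: phiA; rewrite /= memv_ker => /eqP ->; rewrite addr0.
have K_le (l : R) : 0 < l ->
    (forall z, l * dot (A z) z <= q z) -> (K <= l^-1%:E)%E.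
  move=> l0 lP; apply: ge_ereal_sup => _ [v [vA /seminorm_eq1 Av1] <-].
  have [phi phiA le] := inf_energy_le l v l0 lP (Av1 Asp).
  rewrite (@le_trans _ _ (dot (Bbar^-1%VF (v + phi)) (v + phi))%:E) ?lee_fin //.
  by apply: ereal_inf_lbound; exists phi.
have [z0 Az0] : exists z, dot (A z) z = 1.
  have [v Av] : exists v, A v != 0.
    apply: contrapT => A0; move/eqP: An0; apply; apply/lfunP => v.
    rewrite zero_lfunE; apply/eqP/negPn/negP => Av.
    by apply: A0; exists v.
  by have [t _ tP] := semi_spd_normalize Asp Av; exists (t *: v).
have q_gt0 z : dot (A z) z = 1 -> 0 < q z.
  move=> Az1; apply: Bspd.2; apply: contra_eq_neq Az1 => ->.
  by rewrite linear0l eq_sym oner_eq0.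
(* [K_ge] and [K_le] trap [K] between reals, so extended arithmetic reduces to real arithmetic. *)
have [k kE] : exists k, K = k%:E.
  have [C C0 CP] := symmetrized_energy_coercive.
  have Ci0 : 0 < C^-1 by rewrite invr_gt0.
  have CiP z : C^-1 * dot (A z) z <= q z by rewrite ler_pdivrMl.
  have := K_le _ Ci0 CiP; have := K_ge _ Az0.
  by case: K {K_ge K_le} => // k; exists k.
rewrite kE in K_ge K_le *.
have k0 : 0 < k.
  by rewrite -lte_fin (lt_le_trans _ (K_ge _ Az0)) // lte_fin invr_gt0 q_gt0.
have q_ge z : dot (A z) z = 1 -> k^-1 <= q z.
  move=> Az1; have := K_ge _ Az1; rewrite lee_fin => le.
  by rewrite -[q z]invrK lef_pV2 // posrE invr_gt0 q_gt0.
have errE z : dot (A z) z = 1 ->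
    seminorm dot A ((\1%VF - (B \o A)%VF) z) = Num.sqrt (1 - q z).
  by move=> Az1; rewrite /seminorm !lfunE /= !lfunE /= !lfunE /= error_energy Az1.
have q_le1 z : dot (A z) z = 1 -> q z <= 1.
  move=> Az1; rewrite -subr_ge0 -[X in X - _]Az1 -error_energy; exact: Asp.2.
have k1 : 0 <= 1 - k^-1 by rewrite subr_ge0 (le_trans (q_ge _ Az0)) ?q_le1.
set S := op_seminorm _ _ _.
have S_le : (S <= (Num.sqrt (1 - k^-1))%:E)%E.
  apply: ge_ereal_sup => _ [z /seminorm_eq1 Az1 <-].
  by rewrite lee_fin errE ?Az1 // ler_wsqrtr // lerB // q_ge // Az1.
have S_ge z : dot (A z) z = 1 -> ((Num.sqrt (1 - q z))%:E <= S)%E.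
  move=> Az1; apply: ereal_sup_ubound; exists z; first exact/seminorm_eq1.
  by rewrite errE.
have [s sE] : exists s, S = s%:E.
  by have := S_ge _ Az0; case: S S_le {S_ge} => // s; exists s.
rewrite sE in S_le S_ge *.
have s0 : 0 <= s.
  have := S_ge _ Az0; rewrite lee_fin; apply: le_trans; exact: sqrtr_ge0.
rewrite lee_fin in S_le.
have s2 : s ^+ 2 <= 1 - k^-1.
  by rewrite -(sqr_sqrtr k1) lerXn2r // nnegrE sqrtr_ge0.
(* As [k] is nonzero, the extended inverse is the real one; only [1 - k^-1 <= s ^+ 2] is then left
   to prove. *)
rewrite inver gt_eqF // -EFinB -EFin_expe; congr EFin.
apply/eqP; rewrite eq_le s2 /=.
have l0 : 0 < 1 - s ^+ 2.
  by rewrite subr_gt0 (le_lt_trans s2) // ltrBlDr ltrDl invr_gt0.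
(* Normalizing [z] shows that [1 - s ^+ 2] is an admissible [l] in [K_le], so
   [k <= (1 - s ^+ 2)^-1], the missing inequality. *)
have lP z : (1 - s ^+ 2) * dot (A z) z <= q z.
  have [Az0'|Azn0] := eqVneq (A z) 0.
    by rewrite /q Az0' !linear0l mulr0 linear0r.
  have [t t0 tP] := semi_spd_normalize Asp Azn0.
  have := S_ge _ tP; rewrite lee_fin => le.
  have : 1 - q (t *: z) <= s ^+ 2.
    rewrite -(sqr_sqrtr (_ : 0 <= 1 - q (t *: z))) ?subr_ge0 ?q_le1 //.
    by rewrite lerXn2r // nnegrE sqrtr_ge0.
  have AtE : A (t *: z) = t *: A z by rewrite linearZ.
  have BAtE : Bbar (A (t *: z)) = t *: Bbar (A z) by rewrite AtE linearZ.
  have -> : q (t *: z) = t ^+ 2 * q z.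
    by rewrite /q BAtE AtE dotZl dotZr mulrA -expr2.
  rewrite AtE dotZl dotZr mulrA -expr2 in tP.
  have t20 : 0 < t ^+ 2 by rewrite exprn_even_gt0.
  by move=> H; rewrite -(ler_pM2l t20) mulrCA tP mulr1; lra.
have := K_le _ l0 lP; rewrite lee_fin => le.
rewrite lerBlDr -lerBlDl -[leLHS]invrK lef_pV2 // posrE //.
by rewrite invr_gt0.
Qed.

End Symmetrized.
End InnerProduct.

Theorem theorem4p4 (R : realType) (V : vectType R) (dot : {dot V for idfun})
    (A B : 'End(V)) (f : V) :
  semi_spd dot A -> A != 0 -> f \in limg A ->
  spd dot (symmetrized dot A B) ->
  method_converges dot A f (iteration A B f) /\
  ((op_seminorm dot A (\1%VF - (B \o A)%VF)%R) ^+ 2 =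
   1 - (ereal_sup
          [set ereal_inf
             [set (dot ((symmetrized dot A B)^-1%VF (v + phi)%R) (v + phi)%R)%:E
               | phi in [set phi : V | phi \in lker A]]
            | v in [set v : V | v \in limg A /\ seminorm dot A v = 1%R]])^-1)%E.
Proof.
move=> Asp An0 _ Bspd; split; first exact: iteration_converges.
exact: seminorm_contraction_identity.
Qed.
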